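(* Let $(G,+)$ be a group (not necessarily abelian) with identity $0_G$, let $R$ be a reflexive relation on $G$, and let $A,B$ be nonempty subsets of $G$ with $A+B\neq A$. Assume that $R$ is isotone and that $\mathscr{E}(A+B)$ is nonempty. If $0_G P b$ for all $b\in B$, then $\mathscr{E}(A+B)\neq\mathscr{E}(A)$.
   Context: For $x,y\in G$, $xPy$ means that $xRy$ holds and $yRx$ does not. $R$ is isotone if for all $g,g',z\in G$, $gRg'$ implies $(z+g)R(z+g')$ and $(g+z)R(g'+z)$. The sum set is $A+B=\{a+b: a\in A, b\in B\}$. For $S\subseteq G$, $\mathscr{E}(S)$ is the set of efficient points of $S$, i.e. of those $g\in S$ for which there is no $g'\in S$ with $g'Pg$; by convention $\mathscr{E}(\emptyset)=\emptyset$. *)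

(* Defs.v *)
(* MathComp, with classical_sets for arbitrary subsets of a type.

   The library's (possibly infinite, possibly noncommutative) groups
   [groupType] are written multiplicatively: [x * y] and [1] stand for
   x + y and 0_G in additive notation. *)
From mathcomp Require Import ssreflect ssrfun ssrbool eqtype choice monoid.
From mathcomp Require Import boolp classical_sets.

Set Implicit Arguments.
Unset Strict Implicit.
Unset Printing Implicit Defensive.

Local Open Scope classical_set_scope.
Local Open Scope group_scope.

Definition strict_part (T : Type) (R : T -> T -> Prop) (x y : T) : Prop :=
  R x y /\ ~ R y x.

Definition isotone (G : groupType) (R : G -> G -> Prop) : Prop :=
  forall g g' z : G, R g g' -> R (z * g) (z * g') /\ R (g * z) (g' * z).

Definition sumset (G : groupType) (A B : set G) : set G :=
  [set a * b | a in A & b in B].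

(* [strict_part R x y] reads "x is better than y". *)
Definition efficient (T : Type) (R : T -> T -> Prop) (S : set T) : set T :=
  [set g | S g /\ ~ exists2 g', S g' & strict_part R g' g].

(* Main.v *)
Require Import Defs.
From mathcomp Require Import ssreflect ssrfun ssrbool eqtype choice monoid.
From mathcomp Require Import boolp classical_sets.

Local Open Scope classical_set_scope.

(** Translation by a group element can be undone, so isotonicity also reflects
    [R]; this is what transports the negative half of [strict_part]. *)
Lemma isotone_strict_part_mull (G : groupType) (R : G -> G -> Prop) (z x y : G) :
  isotone R -> strict_part R x y -> strict_part R (z * x)%g (z * y)%g.
Proof.
move=> iso [Rxy nRyx]; split; first by have [] := iso x y z Rxy.
by move=> /(iso _ _ z^-1%g) []; rewrite !mulKg.
Qed.

(** Translating [1 P b] by [a] gives [a P a * b]: every point of the sumset is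
    strictly dominated by its own summand in [A]. *)
Lemma sumset_not_efficient (G : groupType) (R : G -> G -> Prop) (A B : set G)
  (x : G) :
  isotone R -> (forall b, B b -> strict_part R 1%g b) ->
  sumset A B x -> ~ efficient R A x.
Proof.
move=> iso PB [a Aa [b Bb <-]] [_]; apply; exists a => //.
by have := isotone_strict_part_mull G R a 1%g b iso (PB b Bb); rewrite mulg1.
Qed.

Theorem theorem3 (G : groupType) (R : G -> G -> Prop) (A B : set G)
  (R_refl : forall x : G, R x x)
  (A_neq0 : A !=set0) (B_neq0 : B !=set0)
  (AB_neqA : sumset A B <> A)
  (R_isotone : isotone R)
  (EAB_neq0 : efficient R (sumset A B) !=set0)
  (one_P_B : forall b : G, B b -> strict_part R 1%g b) :
  efficient R (sumset A B) <> efficient R A.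
Proof.
move=> eqE; have [x Ex] := EAB_neq0.
have [ABx _] := Ex; rewrite eqE in Ex.
exact: (sumset_not_efficient G R A B x R_isotone one_P_B ABx Ex).
Qed.
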